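(* Let $\varphi_0,\ldots,\varphi_{p+q}\colon\mathbb{R}^n\to\overline{\mathbb{R}}$, $I=\{1,\ldots,p\}$, $J=\{p+1,\ldots,p+q\}$, and consider the problem $$\min\{\varphi_0(z)\mid \varphi_i(z)\le 0\ (i\in I),\ \varphi_i(z)=0\ (i\in J)\}.$$ Let $\bar z$ be a local minimizer of this problem such that $\varphi_0,\ldots,\varphi_{p+q}$ are locally Lipschitz continuous in a neighborhood of $\bar z$. Then the following assertions hold. (a) If $\bar z$ is weakly asymptotically $\partial$-regular (wA$\partial$-regular), then $\bar z$ is $\partial^{\mathrm c}$-stationary. (b) If $\bar z$ is asymptotically $\partial$-regular (A$\partial$-regular), then $\bar z$ is $\partial$-stationary.
   Context: $\overline{\mathbb{R}}=\mathbb{R}\cup\{-\infty,\infty\}$. For a closed set $A\subset\mathbb{R}^n$ and $\bar z\in A$, the regular normal cone is $\widehat{\mathcal N}_A(\bar z)=\{\xi\mid \forall z\in A:\ \xi^\top(z-\bar z)\le o(\|z-\bar z\|)\}$ and the limiting normal cone is $\mathcal N_A(\bar z)=\limsup_{z\to\bar z,\,z\in A}\widehat{\mathcal N}_A(z)$. For a function $\psi$ that is locally Lipschitz continuous at $\bar z$, the limiting (Mordukhovich) subdifferential is $\partial\psi(\bar z)=\{\xi\mid(\xi,-1)\in\mathcal N_{\operatorname{epi}\psi}(\bar z,\psi(\bar z))\}$ and the Clarke subdifferential is $\partial^{\mathrm c}\psi(\bar z)=\operatorname{conv}\partial\psi(\bar z)$. Subdifferentials are only considered at points near which the function is Lipschitz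 continuous. The outer limit of a set-valued map $\Gamma\colon\mathbb{R}^n\rightrightarrows\mathbb{R}^m$ at $\bar z$ is $\limsup_{z\to\bar z}\Gamma(z)=\{\xi\mid\exists z^k\to\bar z,\ \xi^k\to\xi,\ \xi^k\in\Gamma(z^k)\ \forall k\}$ (restricted to $z^k\in A$ when written $z\to\bar z$, $z\in A$). Let $\partial^{\square}$ stand for either $\partial$ or $\partial^{\mathrm c}$. A feasible point $\bar z$ is $\partial^\square$-stationary if there is $\lambda\in\mathbb{R}^{p+q}$ with $$0\in\partial\varphi_0(\bar z)+\sum_{i\in I}\lambda_i\,\partial^\square\varphi_i(\bar z)+\sum_{i\in J}\lambda_i\bigl(\partial^\square\varphi_i(\bar z)\cup\partial^\square(-\varphi_i)(\bar z)\bigr),$$ $\min(\lambda_i,-\varphi_i(\bar z))=0$ for $i\in I$, and $\lambda_i\ge0$ for $i\in J$ (note that $\partial\varphi_0$ is the limiting subdifferential in both cases). For a fixed feasible point $\bar z$ let $I(\bar z)=\{i\in I\mid\varphi_i(\bar z)=0\}$ and define, for $z\in\mathbb{R}^n$ (near $\bar z$), $$\overline{\mathcal M}^{\square}(z)=\bigcup_{\lambda_i\ge0\,(i\in I(\bar z)\cup J)}\Bigl[\sum_{i\in I(\bar z)}\lambda_i\,\partial^\square\varphi_i(z)+\sum_{i\in J}\lambda_i\bigl(\partial^\square\varphi_i(z)\cup\partial^\square(-\varphi_i)(z)\bigr)\Bigr].$$ Write $\overline{\mathcal M}$ for the case $\partial^\square=\partial$ and $\overline{\mathcal M}^{\mathrm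 c}$ for the case $\partial^\square=\partial^{\mathrm c}$. The point $\bar z$ is A$\partial$-regular if $\limsup_{z\to\bar z}\overline{\mathcal M}(z)\subset\overline{\mathcal M}(\bar z)$, and wA$\partial$-regular if $\limsup_{z\to\bar z}\overline{\mathcal M}(z)\subset\overline{\mathcal M}^{\mathrm c}(\bar z)$. *)

(* Defs.v *)
From HB Require Import structures.
From mathcomp Require Import all_boot all_order all_algebra.
From mathcomp Require Import all_classical all_reals all_analysis.

Set Implicit Arguments.
Unset Strict Implicit.
Unset Printing Implicit Defensive.

Import Order.TTheory GRing.Theory Num.Theory.
Import numFieldNormedType.Exports.

Local Open Scope classical_set_scope.
Local Open Scope ring_scope.

Definition dot (R : realType) (n : nat) (x y : 'rV[R]_n) : R :=
  \sum_(i < n) x 0 i * y 0 i.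

(* The library norm `|x| on 'rV[R]_n is the max norm; limits and
   neighborhoods below use the library topology, which both norms induce. *)
Definition enorm (R : realType) (n : nat) (x : 'rV[R]_n) : R :=
  Num.sqrt (dot x x).

(* Outer limit of Gam at zbar along A; A = setT is the unrestricted one. *)
Definition outer_limit (R : realType) (n m : nat) (A : set 'rV[R]_n)
    (Gam : 'rV[R]_n -> set 'rV[R]_m) (zbar : 'rV[R]_n) : set 'rV[R]_m :=
  [set xi | exists (z : nat -> 'rV[R]_n) (x : nat -> 'rV[R]_m),
    [/\ z @ \oo --> zbar, x @ \oo --> xi
      & forall k : nat, A (z k) /\ Gam (z k) (x k)]].

Definition regular_normal_cone (R : realType) (n : nat) (A : set 'rV[R]_n)
    (zbar : 'rV[R]_n) : set 'rV[R]_n :=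
  [set xi | forall e : R, 0 < e ->
    \forall z \near zbar, A z -> dot xi (z - zbar) <= e * enorm (z - zbar)].

Definition limiting_normal_cone (R : realType) (n : nat) (A : set 'rV[R]_n)
    (zbar : 'rV[R]_n) : set 'rV[R]_n :=
  outer_limit A (regular_normal_cone A) zbar.

(* R^n x R is encoded as 'rV[R]_(n + 1), with (z, a) = pair_rV z a. *)
Definition pair_rV (R : realType) (n : nat) (z : 'rV[R]_n) (a : R) :
  'rV[R]_(n + 1) := row_mx z a%:M.

Definition epi (R : realType) (n : nat) (psi : 'rV[R]_n -> \bar R) :
    set 'rV[R]_(n + 1) :=
  [set w | exists (z : 'rV[R]_n) (a : R),
    w = pair_rV z a /\ (psi z <= a%:E)%E].

Definition locally_lipschitz (R : realType) (n : nat)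
    (psi : 'rV[R]_n -> \bar R) (z : 'rV[R]_n) : Prop :=
  exists (L : R) (U : set 'rV[R]_n),
    [/\ nbhs z U, forall x, U x -> psi x \is a fin_num
      & forall x y, U x -> U y ->
          `|fine (psi x) - fine (psi y)| <= L * enorm (x - y)].

(* Meant for points near which psi is Lipschitz; empty where psi is
   infinite. *)
Definition subdiff (R : realType) (n : nat) (psi : 'rV[R]_n -> \bar R)
    (zbar : 'rV[R]_n) : set 'rV[R]_n :=
  [set xi | exists2 a : R, psi zbar = a%:E &
    limiting_normal_cone (epi psi) (pair_rV zbar a) (pair_rV xi (-1))].

Definition convex_hull (R : realType) (n : nat) (A : set 'rV[R]_n) :
    set 'rV[R]_n :=
  smallest (@convex_set R 'rV[R]_n) A.

Definition clarke_subdiff (R : realType) (n : nat)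
    (psi : 'rV[R]_n -> \bar R) (zbar : 'rV[R]_n) : set 'rV[R]_n :=
  convex_hull (subdiff psi zbar).

Definition set_add (R : realType) (n : nat) (A B : set 'rV[R]_n) :
    set 'rV[R]_n :=
  [set a + b | a in A & b in B].

Definition set_scale (R : realType) (n : nat) (l : R) (A : set 'rV[R]_n) :
    set 'rV[R]_n :=
  [set l *: a | a in A].

(* Minkowski sum of the A i over the indices i satisfying P. *)
Definition set_sum (R : realType) (n : nat) (T : finType) (P : pred T)
    (A : T -> set 'rV[R]_n) : set 'rV[R]_n :=
  [set \sum_(i | P i) x i |
     x in [set x : T -> 'rV[R]_n | forall i, P i -> A i (x i)]].

(* Constraint indices 1, ..., p + q are shifted to 0, ..., p + q - 1: the
   first p are the inequalities, the last q the equalities. *)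
Definition ineq_idx (p q : nat) (i : 'I_(p + q)) : bool := (i < p)%N.

Definition eq_idx (p q : nat) (i : 'I_(p + q)) : bool := (p <= i)%N.

Definition active_idx (R : realType) (n p q : nat)
    (phi : 'I_(p + q) -> 'rV[R]_n -> \bar R) (zbar : 'rV[R]_n)
    (i : 'I_(p + q)) : bool :=
  ineq_idx i && (phi i zbar == 0%E).

Definition feasible (R : realType) (n p q : nat)
    (phi : 'I_(p + q) -> 'rV[R]_n -> \bar R) : set 'rV[R]_n :=
  [set z | (forall i, ineq_idx i -> (phi i z <= 0)%E) /\
           (forall i, eq_idx i -> phi i z = 0%E)].

Definition local_minimizer (R : realType) (n p q : nat)
    (phi0 : 'rV[R]_n -> \bar R) (phi : 'I_(p + q) -> 'rV[R]_n -> \bar R)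
    (zbar : 'rV[R]_n) : Prop :=
  feasible phi zbar /\
  \forall z \near zbar, feasible phi z -> (phi0 zbar <= phi0 z)%E.

(* In the following definitions sd is one of the subdifferentials
   subdiff and clarke_subdiff. *)
Definition multiplier_sum (R : realType) (n p q : nat)
    (sd : ('rV[R]_n -> \bar R) -> 'rV[R]_n -> set 'rV[R]_n)
    (phi : 'I_(p + q) -> 'rV[R]_n -> \bar R) (P : pred 'I_(p + q))
    (lam : 'rV[R]_(p + q)) (z : 'rV[R]_n) : set 'rV[R]_n :=
  set_add
    (set_sum P (fun i => set_scale (lam 0 i) (sd (phi i) z)))
    (set_sum (@eq_idx p q) (fun i => set_scale (lam 0 i)
       (sd (phi i) z `|` sd (fun x => - phi i x)%E z))).

Definition stationary (R : realType) (n p q : nat)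
    (sd : ('rV[R]_n -> \bar R) -> 'rV[R]_n -> set 'rV[R]_n)
    (phi0 : 'rV[R]_n -> \bar R) (phi : 'I_(p + q) -> 'rV[R]_n -> \bar R)
    (zbar : 'rV[R]_n) : Prop :=
  feasible phi zbar /\
  exists lam : 'rV[R]_(p + q),
    [/\ set_add (subdiff phi0 zbar)
          (multiplier_sum sd phi (@ineq_idx p q) lam zbar) 0,
        forall i, ineq_idx i -> mine (lam 0 i)%:E (- phi i zbar)%E = 0%E
      & forall i, eq_idx i -> 0 <= lam 0 i].

Definition Mbar (R : realType) (n p q : nat)
    (sd : ('rV[R]_n -> \bar R) -> 'rV[R]_n -> set 'rV[R]_n)
    (phi : 'I_(p + q) -> 'rV[R]_n -> \bar R) (zbar z : 'rV[R]_n) :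
    set 'rV[R]_n :=
  \bigcup_(lam in [set lam : 'rV[R]_(p + q) |
       forall i, active_idx phi zbar i || eq_idx i -> 0 <= lam 0 i])
    multiplier_sum sd phi (active_idx phi zbar) lam z.

Definition A_regular (R : realType) (n p q : nat)
    (phi : 'I_(p + q) -> 'rV[R]_n -> \bar R) (zbar : 'rV[R]_n) : Prop :=
  outer_limit setT (Mbar (@subdiff R n) phi zbar) zbar
  `<=` Mbar (@subdiff R n) phi zbar zbar.

Definition wA_regular (R : realType) (n p q : nat)
    (phi : 'I_(p + q) -> 'rV[R]_n -> \bar R) (zbar : 'rV[R]_n) : Prop :=
  outer_limit setT (Mbar (@subdiff R n) phi zbar) zbar
  `<=` Mbar (@clarke_subdiff R n) phi zbar zbar.

(* Main.v *)
Require Import Defs.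
From mathcomp Require Import all_boot all_order all_algebra.
From mathcomp Require Import all_classical all_reals all_analysis.
From mathcomp Require Import ring lra.
Import numFieldNormedType.Exports.
Set Implicit Arguments.
Unset Strict Implicit.
Unset Printing Implicit Defensive.
Import Order.TTheory GRing.Theory Num.Theory.
Local Open Scope classical_set_scope.
Local Open Scope ring_scope.

(** Write f0, f i for the real-valued restrictions of the data to an open
    neighbourhood U of zbar on which all of them are Lipschitz. Minimizing f0
    z + |z - zbar|^2 + k * (squared constraint violation at z) over a small
    closed ball around zbar gives points z tending to zbar as k grows. At such
    a z an exact sum and chain rule for limiting subgradients yields xi in the
    subdifferential of phi0 with - xi - 2 (z - zbar) in Mbar(z), the
    multiplier of the i-th constraint being the absolute value of the
    derivative of its penalty term; it vanishes at the constraints inactive at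
    zbar, which stay negative near zbar. All these xi are bounded by the
    Lipschitz constant, so they accumulate at some xi in the subdifferential
    of phi0 at zbar, and - xi lies in the outer limit of Mbar at zbar
    (asymptotic_multipliers). Either regularity condition moves - xi into
    Mbar(zbar), with its own subdifferential, and this is stationarity.

    The sum rule (sum_rule) is obtained by decoupling: each function receives
    its own copy of the variable, and the distances of the other copies to
    that of f0 are penalized. Optimality in one copy with the others fixed
    produces a proximal subgradient of that single function, and the proximal
    subgradients add up, by construction, to minus the gradient of the smooth
    terms. When the copies merge, these subgradients converge along a
    subsequence to limiting ones. Proximal subgradients, which need only a
    quadratic support from below, thus replace regular ones throughout;
    limiting_subgradient_subdiff translates their limits into limiting normals
    of the epigraph.

    Both limits, in the penalty parameter and in the decoupling, and also the
    existence of limiting subgradients, are instances of one compactness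
    statement, penalty_localizes. Limits are taken with closures of graphs
    rather than with sequences: closure_compact_fiber extracts the limit
    multipliers, closure_map passes relations to the limit, and only
    closure_outer_limit returns to the sequences of an outer limit. *)

(** * Closures, compactness and penalization *)

(** This is how a relation passes to the limit: the transformation g has to
    be continuous only at the limit point, and A has to be mapped into B only
    nearby. Locality matters for divisions by multipliers that are nonzero at
    the limit. *)
Lemma closure_map (S T : topologicalType) (g : S -> T) (A : set S) (B : set T)
    (p : S) :
  closure A p -> {for p, continuous g} -> (\forall q \near p, A q -> B (g q)) ->
  closure B (g p).
Proof.
move=> Ap gp AB V Vp.
have [q [Aq [ABq Vq]]] := Ap _ (filterI AB (gp _ Vp)).
by exists (g q); split => //; exact: ABq.
Qed.

Lemma closed_map_closure (S T : topologicalType) (g : S -> T) (A : set S)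
    (B : set T) (p : S) :
  closed B -> closure A p -> {for p, continuous g} ->
  (forall q, A q -> B (g q)) -> B (g p).
Proof.
move=> cB Ap gp AB; rewrite (iffLR (closure_id B) cB).
by apply: closure_map Ap gp _; apply: nearW.
Qed.

(** The filter on T generated by the fibers of A over the neighbourhoods of x
    contains the compact K, so it has a cluster point there. In use, the
    fibers consist of bounded multipliers, and the cluster point is the limit
    multiplier. *)
Lemma closure_compact_fiber (S T : topologicalType) (A : set (S * T))
    (K : set T) (x : S) :
  compact K -> (forall U, nbhs x U -> exists y c, [/\ U y, K c & A (y, c)]) ->
  exists2 c, K c & closure A (x, c).
Proof.
move=> cK hA.
pose F := filter_from (nbhs x)
  (fun U => [set c | K c /\ exists2 y, U y & A (y, c)]).
have FF : ProperFilter F.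
  apply: filter_from_proper; last first.
    by move=> U /hA [y [c [Uy Kc Ac]]]; exists c; split => //; exists y.
  apply: filter_from_filter; first by exists setT; exact: filterT.
  move=> U V nU nV; exists (U `&` V); first exact: filterI.
  by move=> c [Kc [y [Uy Vy] Ac]]; split; split=> //; exists y.
have FK : F K by exists setT; [exact: filterT|move=> c []].
have [c [Kc Fc]] := cK F FF FK.
exists c => // W [[U V] /= [nU nV] UVW].
have FU : F [set c | K c /\ exists2 y, U y & A (y, c)] by exists U.
have [c' [[_ [y Uy Ac]] Vc]] := Fc _ V FU nV.
by exists (y, c'); split=> //; exact: UVW.
Qed.

Lemma continuous_at_pair (S T1 T2 : topologicalType) (f : S -> T1) (g : S -> T2)
    (x : S) :
  {for x, continuous f} -> {for x, continuous g} ->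
  {for x, continuous (fun y => (f y, g y))}.
Proof.
move=> cf cg.
exact: (@cvg_pair _ _ _ (nbhs x) (nbhs (f x)) (nbhs (g x)) _ _ _ f g cf cg).
Qed.

(** First countability turns closures into limits of sequences: the k-th term
    is picked in the ball of radius 1/(k+1). *)
Lemma closure_outer_limit (R : realType) (n m : nat) (A : set 'rV[R]_n)
    (Gam : 'rV[R]_n -> set 'rV[R]_m) (z : 'rV[R]_n) (xi : 'rV[R]_m) :
  closure [set p | A p.1 /\ Gam p.1 p.2] (z, xi) -> outer_limit A Gam z xi.
Proof.
move=> cl.
have /choice[w wP] : forall k : nat, exists w : 'rV[R]_n * 'rV[R]_m,
    (A w.1 /\ Gam w.1 w.2) /\ ball (z, xi) k.+1%:R^-1 w.
  move=> k.
  have [|w [Aw Bw]] := cl (ball (z, xi) k.+1%:R^-1).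
    by apply: nbhsx_ballx; rewrite invr_gt0.
  by exists w.
have wcvg : w @ \oo --> (z, xi).
  apply/cvg_ballP => e e0.
  have := near_infty_natSinv_lt (PosNum e0); apply: filterS => k /= /ltW ke.
  by apply: le_ball (proj2 (wP k)).
exists (fun k => (w k).1), (fun k => (w k).2); split.
- exact: cvg_comp wcvg cvg_fst.
- exact: cvg_comp wcvg cvg_snd.
- by move=> k; have [] := wP k.
Qed.

(** Let x k minimize a + k * b. Comparison with x0 gives a (x k) <= a x0 and
    b (x k) <= (a x0 - min a) / k, so every cluster point of x is a zero of b
    where a does not exceed a x0. By strictness it is x0. *)
Lemma penalty_localizes (R : realType) (T : topologicalType) (X : set T)
    (a b : T -> R) (x0 : T) (U : set T) :
  compact X -> {in X, continuous a} -> {in X, continuous b} ->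
  (forall x, X x -> 0 <= b x) -> X x0 -> b x0 = 0 ->
  (forall x, X x -> b x = 0 -> a x <= a x0 -> x = x0) -> nbhs x0 U ->
  exists (k : nat) (x : T),
    [/\ X x, U x & forall y, X y -> a x + k%:R * b x <= a y + k%:R * b y].
Proof.
move=> cX ca cb b0 Xx0 bx0 strict nU.
have X0 : X !=set0 by exists x0.
have minE (f : T -> R) : {in X, continuous f} ->
    exists2 c, X c & forall y, X y -> f c <= f y.
  move=> cf; have cf' : {within X, continuous f}.
    by apply: continuous_in_subspaceT => x; exact: cf.
  have [c cX' h] := compact_EVT_min X0 cX cf'.
  by exists c; [exact: set_mem|move=> y Xy; apply: h; exact: mem_set].
have /choice[x xP] : forall k : nat, exists x, X x /\
    forall y, X y -> a x + k%:R * b x <= a y + k%:R * b y.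
  move=> k; have [|c Xc h] := minE (fun x => a x + k%:R * b x).
    move=> y Xy; apply: cvgD; first exact: ca.
    by apply: cvgM; [exact: cvg_cst|exact: cb].
  by exists c.
have [m Xm am] := minE a ca.
have [|c [Xc cl]] := cX (x @ \oo) _.
  by exists 0%N => // k _; exact: (xP k).1.
have apx e : 0 < e -> forall N : nat, exists2 k, (N <= k)%N &
    [/\ X (x k), a c <= a (x k) + e & b c <= b (x k) + e].
  move=> e0 N.
  have nV : nbhs c ([set y | `|a c - a y| < e] `&` [set y | `|b c - b y| < e]).
    apply: filterI.
      have /cvgrPdist_lt/(_ _ e0) := ca c (mem_set Xc); exact.
    have /cvgrPdist_lt/(_ _ e0) := cb c (mem_set Xc); exact.
  have FN : (x @ \oo) (x @` [set k | (N <= k)%N]).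
    by exists N => // k Nk; exists k.
  have [_ [[k Nk <-] [/= ak bk]]] := cl _ _ FN nV.
  exists k => //; split; first exact: (xP k).1.
    move: ak; rewrite ltr_norml => /andP[]; lra.
  move: bk; rewrite ltr_norml => /andP[]; lra.
have ax k : a (x k) <= a x0.
  have [Xk /(_ _ Xx0)] := xP k; rewrite bx0 mulr0 addr0.
  by have := mulr_ge0 (ler0n R k) (b0 _ Xk); lra.
have ac : a c <= a x0.
  apply/ler_addgt0Pr => e e0; have [k _ [_ h _]] := apx e e0 0%N.
  by have := ax k; lra.
have bc : b c = 0.
  apply/eqP; rewrite eq_le b0 // andbT.
  apply/ler_addgt0Pr => e e0; rewrite add0r.
  have e20 : 0 < e / 2 by rewrite divr_gt0.
  (* Past this N, the bound (a x0 - a m) / k on b is below e / 2. *)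
  have [N Nlt] : exists N : nat, (a x0 - a m) / (e / 2) < N%:R.
    by exists (Num.bound ((a x0 - a m) / (e / 2))); exact: unstable.ltr_bound.
  have [k Nk [Xk _ h]] := apx _ e20 N.+1.
  have k0 : 0 < k%:R :> R by rewrite ltr0n; apply: leq_trans Nk.
  suff : b (x k) <= e / 2 by lra.
  have := (xP k).2 _ Xx0; rewrite bx0 mulr0 addr0 => h1.
  have h2 := am _ Xk.
  rewrite -(ler_pM2l k0); apply: (@le_trans _ _ (a x0 - a m)); first lra.
  rewrite -ler_pdivrMr //; apply: (le_trans (ltW Nlt)).
  by rewrite ler_nat; exact: leq_trans Nk.
have cx0 : c = x0 by exact: strict.
rewrite -cx0 in nU.
have FX : (x @ \oo) (range x) by exists 0%N => // k _; exists k.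
have [_ [[k _ <-] Uk]] := cl _ _ FX nU.
by exists k, (x k); split => //; have [] := xP k.
Qed.

(** * Euclidean geometry of row vectors *)

Lemma continuous_at_sum (R : realType) (T : topologicalType)
    (V : normedModType R) (I : finType) (F : I -> T -> V) (x : T) :
  (forall i, {for x, continuous (F i)}) ->
  {for x, continuous (fun y => \sum_i F i y)}.
Proof.
move=> cF; rewrite unlock /=; elim: (index_enum I) => [|i s IHs] /=.
  exact: cvg_cst.
by apply: cvgD; [exact: cF|exact: IHs].
Qed.

Section euclidean.
Variables (R : realType) (n : nat).
Implicit Types (x y z : 'rV[R]_n) (c : R).

Lemma dotDl x y z : dot (x + y) z = dot x z + dot y z.
Proof. by rewrite -big_split; apply: eq_bigr => i _; rewrite mxE mulrDl. Qed.

Lemma dotC x y : dot x y = dot y x.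
Proof. by apply: eq_bigr => i _; rewrite mulrC. Qed.

Lemma dotZl c x y : dot (c *: x) y = c * dot x y.
Proof. by rewrite mulr_sumr; apply: eq_bigr => i _; rewrite mxE mulrA. Qed.

Lemma dotNl x y : dot (- x) y = - dot x y.
Proof. by rewrite -scaleN1r dotZl mulN1r. Qed.

Lemma dotDr x y z : dot z (x + y) = dot z x + dot z y.
Proof. by rewrite !(dotC z) dotDl. Qed.

Lemma dotZr c x y : dot y (c *: x) = c * dot y x.
Proof. by rewrite !(dotC y) dotZl. Qed.

Lemma dotNr x y : dot y (- x) = - dot y x.
Proof. by rewrite !(dotC y) dotNl. Qed.

Lemma dot_suml (I : finType) (F : I -> 'rV[R]_n) y :
  dot (\sum_i F i) y = \sum_i dot (F i) y.
Proof.
apply: (big_ind2 (fun u v => dot u y = v)) => // [|u a v b <- <-].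
  by rewrite -(scale0r (0 : 'rV[R]_n)) dotZl mul0r.
exact: dotDl.
Qed.

Lemma dot_ge0 x : 0 <= dot x x.
Proof. by apply: sumr_ge0 => i _; rewrite -expr2 sqr_ge0. Qed.

Lemma sqr_enorm x : enorm x ^+ 2 = dot x x.
Proof. by rewrite sqr_sqrtr // dot_ge0. Qed.

Lemma enorm_ge0 x : 0 <= enorm x.
Proof. exact: sqrtr_ge0. Qed.

Lemma enormZ c x : enorm (c *: x) = `|c| * enorm x.
Proof.
by rewrite /enorm dotZl dotZr mulrA -expr2 sqrtrM ?sqr_ge0 // sqrtr_sqr.
Qed.

Lemma norm_le_enorm x : `|x| <= enorm x.
Proof.
rewrite -[leLHS]/(mx_norm x);
  have [->|/mx_norm_neq0[[i j] ->]] := eqVneq (mx_norm x) 0.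
  exact: enorm_ge0.
rewrite /= (ord1 i) -(@ler_pXn2r _ 2) ?nnegrE ?enorm_ge0 // sqr_enorm.
rewrite /dot (bigD1 j) //= real_normK ?num_real // expr2 lerDl.
by apply: sumr_ge0 => k _; rewrite -expr2 sqr_ge0.
Qed.

Lemma coord_le_norm x (j : 'I_n) : `|x 0 j| <= `|x|.
Proof.
rewrite -[leRHS]/(mx_norm x) mx_normrE; apply/bigmax_geP; right.
by exists (0, j).
Qed.

Lemma enorm_le_norm x : enorm x <= n%:R * `|x|.
Proof.
rewrite -(@ler_pXn2r _ 2) ?nnegrE ?enorm_ge0 ?mulr_ge0 // sqr_enorm.
apply: (@le_trans _ _ (\sum_(i < n) `|x| ^+ 2)).
  apply: ler_sum => j _; rewrite -expr2 -real_normK ?num_real //.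
  by rewrite ler_pXn2r ?nnegrE // coord_le_norm.
rewrite sumr_const card_ord exprMn -[leLHS]mulr_natl ler_wpM2r ?sqr_ge0 //.
by rewrite -natrX ler_nat; case: (n) => // k; rewrite leq_pmulr.
Qed.

(** The max norm is dominated by the Euclidean one, so definiteness comes
    from the former. *)
Lemma dot_eq0 x : dot x x = 0 -> x = 0.
Proof.
move=> x0; apply/eqP; rewrite -normr_eq0 eq_le normr_ge0 andbT.
by apply: le_trans (norm_le_enorm x) _; rewrite /enorm x0 sqrtr0.
Qed.

Lemma dot_continuous (T : topologicalType) (f g : T -> 'rV[R]_n) (p : T) :
  {for p, continuous f} -> {for p, continuous g} ->
  {for p, continuous (fun q => dot (f q) (g q))}.
Proof.
move=> cf cg; apply: continuous_at_sum => i; apply: cvgM.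
  exact: (cvg_comp _ _ cf (@coord_continuous _ _ _ _ _ _)).
exact: (cvg_comp _ _ cg (@coord_continuous _ _ _ _ _ _)).
Qed.

Definition sqdist x y : R := dot (x - y) (x - y).

Lemma sqdistC x y : sqdist x y = sqdist y x.
Proof. by rewrite /sqdist -opprB dotNl dotNr opprK. Qed.

Lemma sqdistxx x : sqdist x x = 0.
Proof. by rewrite /sqdist subrr -(scale0r (0 : 'rV[R]_n)) dotZl mul0r. Qed.

Lemma sqdist_ge0 x y : 0 <= sqdist x y.
Proof. exact: dot_ge0. Qed.

Lemma sqdist_eq0 x y : sqdist x y = 0 -> x = y.
Proof. by move=> /dot_eq0/eqP; rewrite subr_eq0 => /eqP. Qed.

(** The exact second order expansion of the squared distance to c at x: it
    makes optimality conditions for penalized functions purely algebraic. *)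
Lemma sqdist_expand (c x y : 'rV[R]_n) :
  sqdist y c = sqdist x c + dot (2 *: (x - c)) (y - x) + sqdist y x.
Proof.
rewrite /sqdist -[y - c](subrKA x) [in LHS]addrC.
move: (x - c) (y - x) => u v.
by rewrite !dotDl !dotDr dotZl (dotC v u); ring.
Qed.

Lemma sqdist_continuous (T : topologicalType) (f g : T -> 'rV[R]_n) (p : T) :
  {for p, continuous f} -> {for p, continuous g} ->
  {for p, continuous (fun q => sqdist (f q) (g q))}.
Proof. by move=> cf cg; apply: dot_continuous; apply: cvgB. Qed.

End euclidean.

(** * Proximal and limiting subgradients *)

Definition proximal_subgradient (R : realType) (n : nat) (f : 'rV[R]_n -> R)
    (z xi : 'rV[R]_n) : Prop :=
  exists c : R, \forall y \near z, f z + dot xi (y - z) - c * sqdist y z <= f y.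

(** Limits of proximal subgradients, encoded as the closure of the graph of
    the proximal subdifferential. For a locally Lipschitz function, nearby
    base points automatically have nearby values, so no convergence of values
    is imposed. *)
Definition limiting_subgradient (R : realType) (n : nat) (f : 'rV[R]_n -> R)
    (z xi : 'rV[R]_n) : Prop :=
  closure [set p | proximal_subgradient f p.1 p.2] (z, xi).

Definition lip_on (R : realType) (n : nat) (U : set 'rV[R]_n) (L : R)
    (f : 'rV[R]_n -> R) : Prop :=
  forall x y, U x -> U y -> `|f x - f y| <= L * enorm (x - y).

Section proximal.
Variables (R : realType) (n : nat).
Implicit Types (f Q : 'rV[R]_n -> R) (x y z : 'rV[R]_n) (U : set 'rV[R]_n).

Lemma lip_on_continuous U (L : R) f z :
  open U -> U z -> 0 <= L -> lip_on U L f -> {for z, continuous f}.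
Proof.
move=> oU Uz L0 lf; apply/(@cvgrPdist_lt _ _ _ (nbhs z)) => e e0.
have d0 : 0 < e / (L * n%:R + 1).
  by rewrite divr_gt0 // ltr_wpDl ?mulr_ge0 ?ler0n.
have nU : nbhs z U by exact: open_nbhs_nbhs.
apply: filterS (filterI nU (nbhsx_ballx z _ d0)) => y [Uy].
rewrite -ball_normE /= ltr_pdivlMr ?ltr_wpDl ?mulr_ge0 ?ler0n // mulrC.
apply: le_lt_trans; apply: le_trans (lf _ _ Uz Uy) _.
apply: le_trans (ler_wpM2l L0 (enorm_le_norm _)) _.
by rewrite mulrA ler_wpM2r // lerDl.
Qed.

Lemma lip_onN U (L : R) f : lip_on U L f -> lip_on U L (fun y => - f y).
Proof. by move=> lf x y Ux Uy; rewrite -opprD normrN; exact: lf. Qed.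

(** Move from z by t * eta with t > 0 small: the linear lower bound grows
    like t |eta|^2, the function by at most |c| L t |eta|. *)
Lemma proximal_bound U (L c : R) f z eta :
  open U -> U z -> 0 <= L -> lip_on U L f ->
  proximal_subgradient (fun y => c * f y) z eta -> enorm eta <= `|c| * L.
Proof.
move=> oU Uz L0 lf [C hC]; rewrite leNgt; apply/negP => lt.
set g := enorm eta in lt *.
have g0 : 0 < g by apply: le_lt_trans lt; rewrite mulr_ge0.
have ct : z + t *: eta @[t --> (0 : R)] --> z.
  rewrite -[X in _ --> X]addr0 -[X in _ + X](scale0r eta).
  by apply: cvgD; [exact: cvg_cst|apply: cvgZl; exact: cvg_id].
have cl : C * t * g @[t --> (0 : R)] --> 0.
  rewrite -[X in _ --> X](mul0r g) -[X in X * _](mulr0 C).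
  by apply: cvgM; [apply: cvgM; [exact: cvg_cst|exact: cvg_id]|exact: cvg_cst].
have n1 : \forall t \near (0 : R), c * f z + dot eta (z + t *: eta - z)
    - C * sqdist (z + t *: eta) z <= c * f (z + t *: eta) by exact: ct _ hC.
have n2 : \forall t \near (0 : R), U (z + t *: eta).
  exact: ct _ (open_nbhs_nbhs (conj oU Uz)).
have n3 : \forall t \near (0 : R), C * t * g < g - `|c| * L.
  by have := cvgr_lt _ cl; apply; rewrite subr_gt0.
have [r /= r0 hr] := (nbhs_ballP (0 : R) _).1 (filterI n1 (filterI n2 n3)).
have t0 : 0 < r / 2 by rewrite divr_gt0.
have [|t1 [t2 t3]] := hr (r / 2).
  rewrite -ball_normE /= sub0r normrN gtr0_norm //.
  by rewrite ltr_pdivrMr // ltr_pMr // ltr1n.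
move: (r / 2) t0 t1 t2 t3 => t t0 /= t1 t2 t3.
have := lf _ _ t2 Uz.
rewrite [z + _]addrC addrK enormZ (gtr0_norm t0) -/g => t4.
move: t1; rewrite /sqdist [z + _]addrC addrK !dotZl !dotZr -sqr_enorm -/g => t1.
have {}t4 : c * (f (t *: eta + z) - f z) <= `|c| * (L * (t * g)).
  apply: le_trans (ler_norm _) _; rewrite normrM.
  by apply: ler_wpM2l.
have tg : 0 < t * g by rewrite mulr_gt0.
have := t3; rewrite -(ltr_pM2l tg); lra.
Qed.

Lemma mul1_fun f : (fun y => 1 * f y) = f.
Proof. by apply/funext => y; rewrite mul1r. Qed.

Lemma proximal_bound1 U (L : R) f z xi :
  open U -> U z -> 0 <= L -> lip_on U L f ->
  proximal_subgradient f z xi -> enorm xi <= L.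
Proof.
rewrite -{2}[f]mul1_fun => oU Uz L0 lf /(proximal_bound oU Uz L0 lf).
by rewrite normr1 mul1r.
Qed.

(** At a local minimizer z of G o f + Q, with G bounded above by a quadratic
    tangent at f z with slope l, and with Q quadratic, l * f has a proximal
    subgradient. The quadratic error of G is controlled by M L^2 |y - z|^2
    because f is Lipschitz. The sign of l is arbitrary: this is the chain
    rule before the multiplier is divided out. *)
Lemma proximal_of_min U (L : R) f z (G : R -> R) (l M : R) Q v (s : R) :
  open U -> U z -> 0 <= L -> lip_on U L f -> 0 <= M ->
  (forall t, G t <= G (f z) + l * (t - f z) + M * (t - f z) ^+ 2) ->
  (forall y, Q y = Q z + dot v (y - z) + s * sqdist y z) ->
  (\forall y \near z, G (f z) + Q z <= G (f y) + Q y) ->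
  proximal_subgradient (fun y => l * f y) z (- v).
Proof.
move=> oU Uz L0 lf M0 hG hQ hmin; exists (s + M * L ^+ 2).
have nU : nbhs z U by exact: open_nbhs_nbhs.
apply: filterS2 hmin nU => y hy Uy.
have h : (f y - f z) ^+ 2 <= L ^+ 2 * sqdist y z.
  rewrite -real_normK ?num_real // /sqdist -sqr_enorm -exprMn.
  by rewrite ler_pXn2r ?nnegrE ?mulr_ge0 ?enorm_ge0 // lf.
have {}h := ler_wpM2l M0 h.
have := hG (f y); rewrite (hQ y) in hy.
rewrite dotNl; lra.
Qed.

Lemma proximal_scale f z eta (a : R) : 0 < a ->
  proximal_subgradient (fun y => a * f y) z eta ->
  proximal_subgradient f z (a^-1 *: eta).
Proof.
move=> a0 [c hc]; exists (a^-1 * c); apply: filterS hc => y hy.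
rewrite -(ler_pM2l a0) dotZl !(mulrDr, mulrN) !mulrA divff ?gt_eqF //.
by rewrite !mul1r.
Qed.

Lemma closed_ball_compact z (r : R) : compact (closed_ball_ Num.norm z r).
Proof.
apply: bounded_closed_compact; last exact: closed_closed_ball_.
exists (`|z| + r); split; first exact: num_real.
move=> M hM y zy; apply: ltW; apply: le_lt_trans hM.
rewrite -[y](subKr z); apply: le_trans (ler_normB _ _) _.
by rewrite lerD2l.
Qed.

Lemma open_closed_ball U z : open U -> U z ->
  exists2 r : R, 0 < r & closed_ball_ Num.norm z r `<=` U.
Proof.
move=> oU Uz; have /nbhs_ballP[r /= r0 rU] : nbhs z U by exact: open_nbhs_nbhs.
exists (r / 2); first by rewrite divr_gt0.
move=> y /= zy; apply: rU; rewrite -ball_normE /=.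
by apply: le_lt_trans zy _; rewrite ltr_pdivrMr // ltr_pMr // ltr1n.
Qed.

Lemma near_closed_ball z y (r : R) : ball z r y -> nbhs y (closed_ball_
  Num.norm z r).
Proof.
move=> By; have : nbhs y (ball z r) by apply: open_nbhs_nbhs; split => //;
  exact: ball_open.
by apply: filterS => w; rewrite -ball_normE; exact: ltW.
Qed.

(** Penalizing the distance to z produces minimizers of f + k |. - z|^2 close
    to z, hence proximal subgradients at points near z. They are bounded by L
    and accumulate. Such an element is needed for every constraint whose
    multiplier is zero, since 0 times an empty set is empty. *)
Lemma limiting_subgradient_ex U (L : R) f z :
  open U -> U z -> 0 <= L -> lip_on U L f -> exists xi, limiting_subgradient f
    z xi.
Proof.
move=> oU Uz L0 lf; have [r r0 rU] := open_closed_ball oU Uz.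
set X := closed_ball_ Num.norm z r in rU.
have [V nV|xi _ ?] := @closure_compact_fiber _ _
    [set p | proximal_subgradient f p.1 p.2] _ z (@closed_ball_compact 0 L);
      last by exists xi.
have [||||||||k [y [Xy [Vy By] ymin]]] :=
  @penalty_localizes R _ X f (fun y => sqdist y z) z
   (V `&` ball z r).
- exact: closed_ball_compact.
- by move=> y /set_mem Xy; apply: lip_on_continuous lf => //; exact: rU.
- move=> y _; apply: sqdist_continuous; first exact: cvg_id.
  exact: cst_continuous.
- by move=> y _; exact: sqdist_ge0.
- by rewrite /X /closed_ball_ /= subrr normr0 ltW.
- exact: sqdistxx.
- by move=> y _ /sqdist_eq0.
- by apply: filterI => //; exact: nbhsx_ballx.
have p1 : proximal_subgradient f y (- (k%:R *: (2 *: (y - z)))).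
  rewrite -[f]mul1_fun.
  apply: (@proximal_of_min U L _ _ id 1 0 (fun y => k%:R * sqdist y z) _ k%:R)
    => //.
  - exact: rU.
  - by move=> t; lra.
  - by move=> w; rewrite (sqdist_expand z y w) !dotZl; ring.
  - by apply: filterS (near_closed_ball By) => w Xw; exact: ymin.
exists y, (- (k%:R *: (2 *: (y - z)))); split => //.
  rewrite /closed_ball_ /= sub0r normrN; apply: le_trans (norm_le_enorm _) _.
  exact: proximal_bound1 oU (rU _ Xy) L0 lf p1.
Qed.

End proximal.

(** * An exact sum and chain rule *)

(** The vector eta is l times a limiting subgradient of f if l > 0, |l| times
    one of - f if l < 0, and 0 if l = 0. It is the form in which limits of
    proximal subgradients of l * f survive when l may converge to zero. *)
Definition signed_subgradient (R : realType) (n : nat) (f : 'rV[R]_n -> R)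
    (l : R) (z eta : 'rV[R]_n) : Prop :=
  [/\ 0 < l -> limiting_subgradient f z (l^-1 *: eta),
      l < 0 -> limiting_subgradient (fun y => - f y) z ((- l)^-1 *: eta)
    & l = 0 -> eta = 0].

Section sum_rule.
Variables (R : realType) (n m : nat).
Variables (f0 : 'rV[R]_n -> R) (f : 'I_m -> 'rV[R]_n -> R).
Variables (G dG : 'I_m -> R -> R) (M L : R) (U : set 'rV[R]_n).
Variables (a z : 'rV[R]_n).
Hypothesis oU : open U.
Hypothesis Uz : U z.
Hypothesis L0 : 0 <= L.
Hypothesis M0 : 0 <= M.
Hypothesis lf0 : lip_on U L f0.
Hypothesis lf : forall i, lip_on U L (f i).
Hypothesis cG : forall i, continuous (G i).
Hypothesis cdG : forall i, continuous (dG i).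
Hypothesis hG : forall i s t,
  G i t <= G i s + dG i s * (t - s) + M * (t - s) ^+ 2.
Hypothesis hmin : \forall y \near z,
  f0 z + sqdist z a + \sum_i G i (f i z) <=
  f0 y + sqdist y a + \sum_i G i (f i y).

Let Y := {ptws 'I_m -> 'rV[R]_n}.
Let Z := (('rV[R]_n * Y) * ('rV[R]_n * Y))%type.

Let proj_at (i : 'I_m) (p : 'rV[R]_n * Y) :
  {for p, continuous (fun q : 'rV[R]_n * Y => q.2 i)}.
Proof.
apply: (@continuous_comp _ _ _ (@snd 'rV[R]_n Y) (fun g : Y => g i)).
  exact: cvg_snd.
exact: (@proj_continuous 'I_m (fun=> 'rV[R]_n) i p.2).
Qed.

(** Apply penalty_localizes on the product of closed balls, the constraint
    being that all copies agree. The extra term |y0 - z|^2 makes z the strict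
    minimizer on the diagonal. The gradients of the coupling terms k |y_i -
    y0|^2 with respect to y_i and to y0 are opposite, so they cancel in the
    sum. *)
Lemma decoupled_critical (W : set ('rV[R]_n * Y)) :
  nbhs (z, (fun _ => z) : Y) W ->
  exists (y0 : 'rV[R]_n) (ys : Y) (xi : 'rV[R]_n) (eta : Y),
    [/\ W (y0, ys), proximal_subgradient f0 y0 xi,
      forall i, proximal_subgradient (fun y => dG i (f i (ys i)) * f i y)
                  (ys i) (eta i),
      U y0 /\ (forall i, U (ys i)) &
      xi + \sum_i eta i + 2 *: (y0 - a) + 2 *: (y0 - z) = 0].
Proof.
move=> nW.
have nU : nbhs z U by exact: open_nbhs_nbhs.
have [r1 /= r10 r1P] := (nbhs_ballP z _).1 (filterI nU hmin).
set r := r1 / 2.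
have r0 : 0 < r by rewrite divr_gt0.
set B := closed_ball_ Num.norm z r.
have BP y : B y -> U y /\ f0 z + sqdist z a + \sum_i G i (f i z) <=
    f0 y + sqdist y a + \sum_i G i (f i y).
  move=> zy; apply: r1P; rewrite -ball_normE /=.
  by apply: le_lt_trans zy _; rewrite ltr_pdivrMr // ltr_pMr // ltr1n.
have Bz : B z by rewrite /B /closed_ball_ /= subrr normr0 ltW.
pose X : set ('rV[R]_n * Y) := B `*` [set ys | forall i, B (ys i)].
pose A (p : 'rV[R]_n * Y) := f0 p.1 + sqdist p.1 a + sqdist p.1 z +
  \sum_i G i (f i (p.2 i)).
pose P (p : 'rV[R]_n * Y) := \sum_i sqdist (p.2 i) p.1.
pose p0 : 'rV[R]_n * Y := (z, fun=> z).
pose V := [set p : 'rV[R]_n * Y | ball z r p.1 /\ forall i, ball z r (p.2 i)].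
have cfst (p : 'rV[R]_n * Y) : {for p, continuous (@fst 'rV[R]_n Y)}.
  exact: cvg_fst.
have nV : nbhs p0 (W `&` V).
  apply: filterI => //; apply: filterI.
    exact: (cfst p0 _ (nbhsx_ballx z _ r0)).
  apply: (@filter_forall _ _ (fun i => [set p : 'rV[R]_n * Y | ball z r (p.2
    i)])
    (nbhs p0)) => i.
  exact: (@proj_at i p0 _ (nbhsx_ballx z _ r0)).
have [||||||||k [[y0 ys] [[/= By0 Bys] [Wp [/= Vy0 Vys]] pmin]]] :=
  @penalty_localizes R _ X A P p0 (W `&` V) => //.
- apply: compact_setX; first exact: closed_ball_compact.
  exact: (@tychonoff 'I_m (fun=> 'rV[R]_n) (fun=> B)
    (fun=> @closed_ball_compact R n z r)).
- move=> p /set_mem [Bp1 Bp2].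
  apply: cvgD; last first.
    apply: continuous_at_sum => i.
    apply: (@continuous_comp _ _ _ (fun q : 'rV[R]_n * Y => f i (q.2 i)));
      last exact: cG.
    apply: (@continuous_comp _ _ _ (fun q : 'rV[R]_n * Y => q.2 i)).
      exact: proj_at.
    by apply: lip_on_continuous (lf i) => //; exact: (BP _ (Bp2 i)).1.
  apply: cvgD; last by apply: sqdist_continuous;
    [exact: cfst|exact: cst_continuous].
  apply: cvgD; last by apply: sqdist_continuous;
    [exact: cfst|exact: cst_continuous].
  apply: (@continuous_comp _ _ _ (@fst 'rV[R]_n Y) f0); first exact: cfst.
  by apply: lip_on_continuous lf0 => //; exact: (BP _ Bp1).1.
- move=> p _; apply: continuous_at_sum => i.
  by apply: sqdist_continuous; [exact: proj_at|exact: cfst].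
- by move=> p _; apply: sumr_ge0 => i _; exact: sqdist_ge0.
- by split.
- by rewrite /P big1 // => i _; exact: sqdistxx.
- move=> [y0 ys] [/= By0 _]; rewrite /P /A /= => h.
  have {}h i : ys i = y0.
    apply: sqdist_eq0; apply/eqP.
    have := h; move/eqP; rewrite psumr_eq0; last by move=> j _;
      exact: sqdist_ge0.
    by move/allP/(_ i); rewrite mem_index_enum; exact.
  have -> : ys = (fun=> y0) by apply/funext.
  rewrite sqdistxx => h2; have := (BP _ By0).2; have := sqdist_ge0 y0 z.
  move=> h3 h4; have /sqdist_eq0 -> : sqdist y0 z = 0 by lra.
  by [].
set xi := - (2 *: (y0 - a) + 2 *: (y0 - z) + k%:R *: \sum_i 2 *: (y0 - ys i)).
pose eta : Y := fun i => - (k%:R *: (2 *: (ys i - y0))).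
exists y0, ys, xi, eta; split => //.
- rewrite -[f0]mul1_fun.
  apply: (@proximal_of_min _ _ U L _ _ id 1 0 (fun y => sqdist y a + sqdist y z
      + k%:R * \sum_i sqdist (ys i) y) _ (2 + k%:R * m%:R)) => //.
    + exact: (BP _ By0).1.
    + by move=> t; lra.
    + move=> y; rewrite (sqdist_expand a y0 y) (sqdist_expand z y0 y).
      under eq_bigr => i _ do rewrite sqdistC (sqdist_expand (ys i) y0 y)
        (sqdistC y0).
      rewrite !big_split /= sumr_const card_ord !dotDl !dotZl dot_suml.
      rewrite -[_ *+ m]mulr_natl; ring.
    + apply: filterS (near_closed_ball Vy0) => y Xy.
      have := pmin (y, ys) (conj Xy Bys).
      by rewrite /A /P /=; lra.
- move=> i.
  apply: (@proximal_of_min _ _ U L _ _ (G i) _ M (fun y => k%:R * sqdist y y0)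
    _ k%:R) => //.
  + exact: (BP _ (Bys i)).1.
  + by move=> y; rewrite (sqdist_expand y0 (ys i) y) !dotZl; ring.
  + apply: filterS (near_closed_ball (Vys i)) => y Xy.
    (* Vary the i-th copy only. *)
    pose ys' : Y := fun j => if j == i then y else ys j.
    have Bys' j : B (ys' j) by rewrite /ys'; case: ifP.
    have := pmin (y0, ys') (conj By0 Bys').
    have D1 F : \sum_j F j = F i + \sum_(j | j != i) F j :> R
      by rewrite (bigD1 i).
    have e1 : \sum_(j | j != i) G j (f j (ys' j)) =
              \sum_(j | j != i) G j (f j (ys j)).
      by apply: eq_bigr => j /negbTE ji; rewrite /ys' ji.
    have e2 : \sum_(j | j != i) sqdist (ys' j) y0 =
              \sum_(j | j != i) sqdist (ys j) y0.
      by apply: eq_bigr => j /negbTE ji; rewrite /ys' ji.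
    rewrite /A /P /= !D1 e1 e2 {1 2}/ys' eqxx.
    by lra.
- by split; [exact: (BP _ By0).1|move=> i; exact: (BP _ (Bys i)).1].
- have -> : \sum_i eta i = k%:R *: \sum_i 2 *: (y0 - ys i).
    rewrite scaler_sumr; apply: eq_bigr => i _.
    by rewrite /eta -2!scalerN opprB.
  rewrite /xi -[RHS](subrr (2 *: (y0 - a) + 2 *: (y0 - z))).
  move: (2 *: (y0 - a)) (2 *: (y0 - z)) (k%:R *: _) => u v w.
  by rewrite !opprD subrK -addrA addrC.
Qed.

(** Let the copies in decoupled_critical tend to z. The vectors xi and eta i
    stay bounded by proximal_bound and accumulate. Where the limit multiplier
    is nonzero it may be divided out before passing to the limit; where it is
    zero, the bound |eta i| <= |multiplier| L forces the limit of eta i to be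
    0. *)
Lemma sum_rule : exists (xi : 'rV[R]_n) (eta : 'I_m -> 'rV[R]_n),
  [/\ limiting_subgradient f0 z xi, `|xi| <= L,
    forall i, signed_subgradient (f i) (dG i (f i z)) z (eta i) &
    xi + \sum_i eta i + 2 *: (z - a) = 0].
Proof.
pose D : set (('rV[R]_n * Y) * ('rV[R]_n * Y)) := [set p |
  [/\ proximal_subgradient f0 p.1.1 p.2.1,
    forall i, proximal_subgradient (fun y => dG i (f i (p.1.2 i)) * f i y)
                (p.1.2 i) (p.2.2 i),
    forall i, U (p.1.2 i) &
    p.2.1 + \sum_i p.2.2 i + 2 *: (p.1.1 - a) + 2 *: (p.1.1 - z) = 0]].
pose l i := dG i (f i z).
pose K : set ('rV[R]_n * Y) := closed_ball_ Num.norm 0 L `*`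
  [set eta | forall i, closed_ball_ Num.norm 0 ((`|l i| + 1) * L) (eta i)].
have cK : compact K.
  apply: compact_setX; first exact: closed_ball_compact.
  exact: (@tychonoff 'I_m (fun=> 'rV[R]_n)
    (fun i => closed_ball_ Num.norm 0 ((`|l i| + 1) * L))
    (fun i => @closed_ball_compact R n 0 ((`|l i| + 1) * L))).
pose p0 : 'rV[R]_n * Y := (z, fun=> z).
have cl i : {for p0, continuous (fun p : 'rV[R]_n * Y => dG i (f i (p.2 i)))}.
  apply: (@continuous_comp _ _ _ (fun q : 'rV[R]_n * Y => f i (q.2 i)));
    last exact: cdG.
  apply: (@continuous_comp _ _ _ (fun q : 'rV[R]_n * Y => q.2 i)).
    exact: proj_at.
  exact: lip_on_continuous (lf i).
have norm_sub0 (y : 'rV[R]_n) (s : R) : closed_ball_ Num.norm 0 s y = (`|y| <=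
  s) :> Prop.
  by rewrite /closed_ball_ /= sub0r normrN.
have [W nW|[xi eta] [/= Kxi Keta] clD] := @closure_compact_fiber _ _ D K p0 cK.
  (* Near the limit, the multipliers exceed those at z by less than 1, so
     the eta i stay in the compact set K. *)
  pose W' := [set p : 'rV[R]_n * Y | forall i, `|l i - dG i (f i (p.2 i))| < 1].
  have nW' : nbhs p0 W'.
    apply: (@filter_forall _ _ (fun i => [set p : 'rV[R]_n * Y |
      `|l i - dG i (f i (p.2 i))| < 1]) (nbhs p0)) => i.
    exact: ((@cvgrPdist_lt _ _ _ (nbhs p0) _ _ _).1 (cl i) 1 ltr01).
  have [y0 [ys [xi [eta [[Wy W'y] h1 h2 [h3 h4] h5]]]]] :=
    decoupled_critical (filterI nW nW').
  exists (y0, ys), (xi, eta); split => //.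
  split => /=; first rewrite norm_sub0.
    exact: le_trans (norm_le_enorm _) (proximal_bound1 oU h3 L0 lf0 h1).
  move=> i; rewrite norm_sub0; apply: le_trans (norm_le_enorm _) _.
  apply: le_trans (proximal_bound oU (h4 i) L0 (lf i) (h2 i)) _.
  apply: ler_wpM2r => //; have := W'y i; rewrite distrC => /ltW h.
  by rewrite -[X in `|X|](subrK (l i)) addrC;
    apply: le_trans (ler_normD _ _) _; rewrite lerD2l.
pose P0 : ('rV[R]_n * Y) * ('rV[R]_n * Y) := (p0, (xi, eta)).
have c11 : {for P0, continuous (fun p : Z => p.1.1)}.
  by apply: (@continuous_comp _ _ _ fst fst); exact: cvg_fst.
have c21 : {for P0, continuous (fun p : Z => p.2.1)}.
  by apply: (@continuous_comp _ _ _ snd fst); [exact: cvg_snd|exact: cvg_fst].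
have c12 i : {for P0, continuous (fun p : Z => p.1.2 i)}.
  apply: (@continuous_comp _ _ _ fst (fun q : 'rV[R]_n * Y => q.2 i));
    first exact: cvg_fst.
  exact: proj_at.
have c22 i : {for P0, continuous (fun p : Z => p.2.2 i)}.
  apply: (@continuous_comp _ _ _ snd (fun q : 'rV[R]_n * Y => q.2 i));
    first exact: cvg_snd.
  exact: proj_at.
have cdGf i : {for P0, continuous (fun p : Z =>
    dG i (f i (p.1.2 i)))}.
  apply: (@continuous_comp _ _ _ fst (fun q : 'rV[R]_n * Y => dG i (f i (q.2
    i)))).
    exact: cvg_fst.
  exact: cl.
exists xi, eta; split.
- have := @closure_map _ _ (fun p : Z => (p.1.1, p.2.1)) D
    [set p | proximal_subgradient f0 p.1 p.2] P0 clD; apply.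
    exact: (continuous_at_pair c11 c21).
  by apply: (@nearW _ (nbhs P0)) => p [].
- by rewrite -norm_sub0.
- move=> i; rewrite -/(l i); split => li.
  + have := @closure_map _ _ (fun p : Z => (p.1.2 i, (dG i (f i (p.1.2 i)))^-1
    *: p.2.2 i)) D
      [set p | proximal_subgradient (f i) p.1 p.2] P0 clD; apply.
      apply: continuous_at_pair; first exact: c12.
      apply: cvgZ; last exact: c22.
      by apply: cvgV; [rewrite gt_eqF|exact: cdGf].
    have : \forall p \near P0, 0 < dG i (f i (p.1.2 i)).
      exact: (@cvgr_gt _ _ (nbhs P0) _ _ _ (cdGf i)).
    apply: (@filterS _ (nbhs P0)) => p /= p0' [_ /(_ i) h _ _].
    exact: proximal_scale.
  + have := @closure_map _ _ (fun p : Z => (p.1.2 i, (- dG i (f i (p.1.2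
    i)))^-1 *: p.2.2 i)) D
      [set p | proximal_subgradient (fun y => - f i y) p.1 p.2] P0 clD; apply.
      apply: continuous_at_pair; first exact: c12.
      apply: cvgZ; last exact: c22.
      by apply: cvgV; [rewrite gt_eqF // oppr_gt0|apply: cvgN; exact: cdGf].
    have : \forall p \near P0, dG i (f i (p.1.2 i)) < 0.
      exact: (@cvgr_lt _ _ (nbhs P0) _ _ _ (cdGf i)).
    apply: (@filterS _ (nbhs P0)) => p /= p0' [_ /(_ i) [c hc] _ _].
    apply: proximal_scale; first by rewrite oppr_gt0.
    by exists c; apply: filterS hc => y; rewrite !mulrNN.
  + have := @closed_map_closure _ _ (fun p : Z => `|dG i (f i (p.1.2 i))| * L
    - `|p.2.2 i|)
      D [set t | 0 <= t] P0 (@closed_ge R 0) clD.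
    rewrite /= -/(l i) li normr0 mul0r sub0r oppr_ge0 => h.
    apply/eqP; rewrite -normr_le0; apply: h.
      apply: cvgB; last by apply: cvg_norm; exact: c22.
      apply: cvgM; last exact: cvg_cst.
      by apply: cvg_norm; exact: cdGf.
    move=> p [_ /(_ i) h1 /(_ i) h2 _]; rewrite subr_ge0.
    apply: le_trans (norm_le_enorm _) _.
    exact: proximal_bound (lf i) h1.
- have := @closed_map_closure _ _ (fun p : Z => p.2.1 + \sum_i p.2.2 i +
    2 *: (p.1.1 - a) + 2 *: (p.1.1 - z)) D [set 0] P0 _ clD.
  rewrite /= subrr scaler0 addr0; apply.
  + exact: (accessible_closed_set1 (hausdorff_accessible (@norm_hausdorff _
    _))).
  + apply: cvgD; last first.
      by apply: cvgZr; apply: cvgB; [exact: c11|exact: cvg_cst].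
    apply: cvgD; last first.
      by apply: cvgZr; apply: cvgB; [exact: c11|exact: cvg_cst].
    apply: cvgD; first exact: c21.
    exact: (@continuous_at_sum R Z 'rV[R]_n 'I_m (fun i (p : Z) => p.2.2 i) P0
      c22).
  + by move=> p [].
Qed.

End sum_rule.

(** * From limiting subgradients to limiting normals of the epigraph *)

Section epigraph.
Variables (R : realType) (n : nat).
Implicit Types (x y z xi : 'rV[R]_n) (a b : R).

Lemma dot_pair x y a b : dot (pair_rV x a) (pair_rV y b) = dot x y + a * b.
Proof.
rewrite /dot big_split_ord /= big_ord1; congr (_ + _).
  by apply: eq_bigr => i _; rewrite !row_mxEl.
by rewrite !row_mxEr !mxE.
Qed.

Lemma pair_rVB x y a b : pair_rV x a - pair_rV y b = pair_rV (x - y) (a - b).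
Proof. by rewrite /pair_rV opp_row_mx add_row_mx raddfB. Qed.

Lemma pair_rV_continuous (T : topologicalType) (h : T -> 'rV[R]_n) (k : T -> R)
    (p : T) : {for p, continuous h} -> {for p, continuous k} ->
  {for p, continuous (fun q => pair_rV (h q) (k q))}.
Proof.
move=> ch ck; apply/(@cvg_ballP _ _ _ (nbhs p)) => e e0.
have nh : \forall q \near p, ball (h p) e (h q)
  by exact: ch _ (nbhsx_ballx (h p) _ e0).
have nk : \forall q \near p, ball (k p) e (k q)
  by exact: ck _ (nbhsx_ballx (k p) _ e0).
apply: (@filterS _ (nbhs p)) (filterI nh nk) => q [[_ hq] kq].
refine (conj e0 _) => i j; rewrite (ord1 i); case: (split_ordP j) => j' ->.
  by rewrite !row_mxEl; exact: hq.
by rewrite !row_mxEr (ord1 j') !mxE.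
Qed.

(** For w = (x, b) in the epigraph, b >= f x and the proximal inequality give
    <(xi, -1), w - (y, f y)> <= c |x - y|^2, and the right-hand side is o(|w
    - (y, f y)|). *)
Lemma proximal_regular_normal (U : set 'rV[R]_n) (psi : 'rV[R]_n -> \bar R) f
    y xi :
  open U -> U y -> (forall x, U x -> psi x = (f x)%:E) ->
  proximal_subgradient f y xi ->
  regular_normal_cone (epi psi) (pair_rV y (f y)) (pair_rV xi (-1)).
Proof.
move=> oU Uy psiE [c hc] e e0.
have d0 : 0 < e / (`|c| * n%:R + 1).
  by rewrite divr_gt0 // ltr_wpDl ?mulr_ge0 ?ler0n.
have nU : nbhs y U by exact: open_nbhs_nbhs.
have [r /= r0 hr] := (nbhs_ballP y _).1
  (filterI hc (filterI nU (nbhsx_ballx y _ d0))).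
apply: filterS (nbhsx_ballx (pair_rV y (f y)) _ r0) => w bw [x [b [wE xb]]].
rewrite {w}wE in bw *.
have [|h1 [Ux h2]] := hr x.
  refine (conj r0 _) => i j; have := bw.2 i (lshift 1 j); by rewrite !row_mxEl.
rewrite psiE // lee_fin in xb.
rewrite pair_rVB dot_pair.
have le1 : enorm (x - y) <= enorm (pair_rV (x - y) (b - f y)).
  rewrite /enorm ler_wsqrtr // dot_pair lerDl -expr2; exact: sqr_ge0.
have le2 : `|c| * enorm (x - y) <= e.
  move: h2; rewrite -ball_normE /= distrC ltr_pdivlMr; last first.
    by rewrite ltr_wpDl ?mulr_ge0 ?ler0n.
  move=> /ltW; apply: le_trans.
  apply: le_trans (ler_wpM2l (normr_ge0 c) (enorm_le_norm _)) _.
  by rewrite mulrA [leRHS]mulrC ler_wpM2r // lerDl.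
apply: le_trans (ler_wpM2l (ltW e0) le1).
apply: (@le_trans _ _ (c * sqdist x y)); first by move: h1 xb; lra.
apply: le_trans (ler_wpM2r (enorm_ge0 _) le2).
by rewrite -mulrA -expr2 sqr_enorm ler_wpM2r ?sqdist_ge0 // ler_norm.
Qed.

Lemma limiting_subgradient_subdiff (U : set 'rV[R]_n) (L : R)
    (psi : 'rV[R]_n -> \bar R) f z xi :
  open U -> U z -> 0 <= L -> lip_on U L f ->
  (forall x, U x -> psi x = (f x)%:E) ->
  limiting_subgradient f z xi -> subdiff psi z xi.
Proof.
move=> oU Uz L0 lf psiE lim; exists (f z); first exact: psiE.
apply: closure_outer_limit.
have cf : {for z, continuous f} by exact: lip_on_continuous lf.
have := @closure_map _ _ (fun p : 'rV[R]_n * 'rV[R]_n =>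
  (pair_rV p.1 (f p.1), pair_rV p.2 (-1))) _ _ (z, xi) lim; apply.
  have c1 : {for (z, xi), continuous (@fst 'rV[R]_n 'rV[R]_n)}
    by exact: cvg_fst.
  have c2 : {for (z, xi), continuous (@snd 'rV[R]_n 'rV[R]_n)}
    by exact: cvg_snd.
  have cf1 : {for (z, xi), continuous (fun p : 'rV[R]_n * 'rV[R]_n => f p.1)}.
    exact: (@continuous_comp _ _ _ (@fst 'rV[R]_n 'rV[R]_n) f _ c1 cf).
  have cm1 : {for (z, xi), continuous (fun p : 'rV[R]_n * 'rV[R]_n => -1 : R)}.
    exact: cst_continuous.
  apply: continuous_at_pair.
    exact: (pair_rV_continuous c1 cf1).
  exact: (pair_rV_continuous c2 cm1).
have : \forall q \near (z, xi), U q.1.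
  have nU : nbhs z U by exact: open_nbhs_nbhs.
  exact: (cvg_fst nU).
apply: (@filterS _ (nbhs (z, xi))) => q Uq /= hq; split.
  by exists q.1, (f q.1); rewrite psiE.
exact: (proximal_regular_normal oU Uq psiE hq).
Qed.

End epigraph.

(** * Squared constraint violation *)

Section penalty_function.
Variables (R : realType).
Implicit Types (b : bool) (s t : R).

Definition penalty b t : R := (if b then Num.max t 0 else t) ^+ 2.

Definition penalty' b t : R := 2 * (if b then Num.max t 0 else t).

Lemma penalty_ge0 b t : 0 <= penalty b t.
Proof. exact: sqr_ge0. Qed.

Lemma penalty_eq0 b t : penalty b t = 0 <-> (if b then t <= 0 else t == 0).
Proof.
rewrite /penalty; case: b; split.
- by move=> /eqP; rewrite sqrf_eq0 => /eqP <-; rewrite le_max lexx.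
- by move=> /max_idPr ->; rewrite expr0n.
- by move=> /eqP; rewrite sqrf_eq0.
- by move=> /eqP ->; rewrite expr0n.
Qed.

(** The derivative of the penalty is 2-Lipschitz, hence the tangent quadratic
    bound from above with constant 1. *)
Lemma penalty_quadratic_bound b s t :
  penalty b t <= penalty b s + penalty' b s * (t - s) + 1 * (t - s) ^+ 2.
Proof.
rewrite /penalty /penalty' mul1r; case: b => /=; last by lra.
rewrite !maxEle; case: (leP t 0) => t0; case: (leP s 0) => s0.
- by have := sqr_ge0 (t - s); lra.
- by have := sqr_ge0 t; lra.
- have : 0 <= t * - s by rewrite mulr_ge0 ?oppr_ge0 // ltW.
  by have := sqr_ge0 s; lra.
- by lra.
Qed.

Lemma continuous_pos_part b : continuous (fun t => if b then Num.max t 0 else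
  t).
Proof.
case: b => t; last exact: cvg_id.
by apply: (@continuous_max _ _ (fun x : R => x) (fun=> 0) t);
  [exact: cvg_id|exact: cvg_cst].
Qed.

Lemma penalty_continuous b : continuous (penalty b).
Proof. by move=> t; apply: cvgM; exact: continuous_pos_part. Qed.

Lemma penalty'_continuous b : continuous (penalty' b).
Proof.
by move=> t; apply: cvgM; [exact: cvg_cst|exact: continuous_pos_part].
Qed.

End penalty_function.

(** * Asymptotic stationarity *)

Section asymptotic_stationarity.
Variables (R : realType) (n p q : nat).
Variables (phi0 : 'rV[R]_n -> \bar R) (phi : 'I_(p + q) -> 'rV[R]_n -> \bar R).
Variable zbar : 'rV[R]_n.

Lemma eq_idxE (i : 'I_(p + q)) : eq_idx i = ~~ ineq_idx i.
Proof. by rewrite /eq_idx /ineq_idx -leqNgt. Qed.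

(** Mbar sums over the inequalities active at zbar and leaves the other
    multipliers of inequalities free, whereas stationarity sums over all
    inequalities: the inactive ones enter with multiplier 0 and an arbitrary
    element of the subdifferential, which therefore must be nonempty. *)
Lemma stationary_of_multipliers
    (sd : ('rV[R]_n -> \bar R) -> 'rV[R]_n -> set 'rV[R]_n) (xi : 'rV[R]_n) :
  feasible phi zbar -> (forall i, sd (phi i) zbar !=set0) ->
  subdiff phi0 zbar xi -> Mbar sd phi zbar zbar (- xi) ->
  stationary sd phi0 phi zbar.
Proof.
move=> feas ne hxi [lam /= lam0 [_ [x hx <-] [_ [y hy <-] sumE]]].
split => //.
have /choice[w hw] i : exists u, sd (phi i) zbar u by exact: ne.
pose l' : 'rV[R]_(p + q) :=
  \row_i if active_idx phi zbar i || eq_idx i then lam 0 i else 0.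
have l'act i : active_idx phi zbar i -> l' 0 i = lam 0 i.
  by move=> ai; rewrite mxE ai.
have l'eq i : eq_idx i -> l' 0 i = lam 0 i by move=> ei; rewrite mxE ei orbT.
have l'in i : ineq_idx i -> ~~ active_idx phi zbar i -> l' 0 i = 0.
  by move=> ii ai; rewrite mxE eq_idxE ii (negbTE ai).
exists l'; split.
- exists xi => //; exists (- xi); last by rewrite subrr.
  exists (\sum_(i | ineq_idx i) if active_idx phi zbar i then x i else 0).
    exists (fun i => if active_idx phi zbar i then x i else 0) => //= i ii.
    case: ifP => ai; first by rewrite l'act //; exact: hx.
    by exists (w i) => //; rewrite l'in ?ai // scale0r.
  exists (\sum_(i | eq_idx i) y i).
    exists y => //= i ei; by rewrite l'eq //; exact: hy.
  rewrite -big_mkcondr /= -sumE; congr (_ + _).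
  by apply: eq_bigl => i; rewrite /active_idx andbA andbb.
- move=> i ii; have [ai|ai] := boolP (active_idx phi zbar i).
    rewrite l'act //; have /andP[_ /eqP ->] := ai.
    by rewrite oppe0; apply: min_idPr; rewrite lee_fin lam0 // ai.
  rewrite l'in //; apply: min_idPl.
  by rewrite leeNr oppe0; exact: feas.1.
- by move=> i ei; rewrite l'eq // lam0 // ei orbT.
Qed.

Variables (f0 : 'rV[R]_n -> R) (f : 'I_(p + q) -> 'rV[R]_n -> R).
Variables (L : R) (U : set 'rV[R]_n).
Hypothesis oU : open U.
Hypothesis L0 : 0 <= L.
Hypothesis lf0 : lip_on U L f0.
Hypothesis lf : forall i, lip_on U L (f i).
Hypothesis phi0E : forall y, U y -> phi0 y = (f0 y)%:E.
Hypothesis phiE : forall i y, U y -> phi i y = (f i y)%:E.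

(** The multiplier of the i-th constraint is |l i|. A negative l i can occur
    only for equality constraints, where the subdifferential of - phi i is
    admitted. *)
Lemma Mbar_signed_sum (z : 'rV[R]_n) (l : 'I_(p + q) -> R)
    (eta : 'I_(p + q) -> 'rV[R]_n) :
  U z -> (forall i, signed_subgradient (f i) (l i) z (eta i)) ->
  (forall i, ineq_idx i -> 0 <= l i) ->
  (forall i, ineq_idx i -> ~~ active_idx phi zbar i -> l i = 0) ->
  Mbar (@subdiff R n) phi zbar z (\sum_i eta i).
Proof.
move=> Uz heta l0 lin.
have sub i v : limiting_subgradient (f i) z v -> subdiff (phi i) z v.
  exact: (limiting_subgradient_subdiff oU Uz L0 (lf i) (phiE i)).
have subN i v : limiting_subgradient (fun y => - f i y) z v ->
    subdiff (fun y => - phi i y)%E z v.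
  apply: (limiting_subgradient_subdiff oU Uz L0 (lip_onN (lf i))) => y Uy.
  by rewrite phiE.
have /choice[x hx] i : exists v, `|l i| *: v = eta i /\
    ((l i < 0 /\ subdiff (fun y => - phi i y)%E z v) \/
     (0 <= l i /\ subdiff (phi i) z v)).
  have [h1 h2 h3] := heta i; have [li|li|li] := ltgtP (l i) 0.
  - exists ((- l i)^-1 *: eta i); split; last by left; split => //;
    exact: subN (h2 li).
    by rewrite ltr0_norm // scalerA divff ?scale1r // oppr_eq0 lt_eqF.
  - exists ((l i)^-1 *: eta i); split; last by right; split => //;
    exact: sub (h1 li).
    by rewrite gtr0_norm // scalerA divff ?scale1r // gt_eqF.
  - have [v hv] := limiting_subgradient_ex oU Uz L0 (lf i).
    exists v; split; last by right; split => //; exact: sub.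
    by rewrite li normr0 scale0r h3.
exists (\row_i `|l i|) => /=; first by move=> i _; rewrite mxE.
exists (\sum_(i | active_idx phi zbar i) eta i).
  exists eta => //= i ai; have ii : ineq_idx i by case/andP: ai.
  exists (x i); last by rewrite mxE (hx i).1.
  by have [_ [[li _]|[_ //]]] := hx i; have := l0 i ii; rewrite leNgt li.
exists (\sum_(i | eq_idx i) eta i).
  exists eta => //= i ei; exists (x i); last by rewrite mxE (hx i).1.
  by have [_ [[_ h]|[_ h]]] := hx i; [right|left].
rewrite [RHS](bigID (@ineq_idx p q)) /=; congr (_ + _); last first.
  by apply: eq_bigl => i; rewrite eq_idxE.
rewrite [RHS](bigID (active_idx phi zbar)) /= [X in _ + X]big1 ?addr0.
  by apply: eq_bigl => i; rewrite /active_idx andbA andbb.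
by move=> i /andP[ii ai]; have [_ _] := heta i; apply; exact: lin.
Qed.

Hypothesis Uzbar : U zbar.
Hypothesis feas : feasible phi zbar.
Hypothesis hmin : forall y, U y -> feasible phi y -> f0 zbar <= f0 y.

Lemma feasible_penalty (y : 'rV[R]_n) : U y ->
  (forall i, penalty (@ineq_idx p q i) (f i y) = 0) <-> feasible phi y.
Proof.
move=> Uy; split => [h|[h1 h2] i].
  split => i hi; have /penalty_eq0 := h i.
    by rewrite hi phiE // lee_fin.
  by rewrite eq_idxE in hi; rewrite (negbTE hi) phiE // => /eqP ->.
apply/penalty_eq0; case: ifP => hi.
  by have := h1 i hi; rewrite phiE // lee_fin.
have := h2 i; rewrite eq_idxE hi phiE // => /(_ isT) [->].
exact: eqxx.
Qed.

(** Strictness in penalty_localizes comes from |. - zbar|^2: a feasible y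
    with f0 y + |y - zbar|^2 <= f0 zbar must be zbar, by local optimality. *)
Lemma penalized_stationary (W : set 'rV[R]_n) : nbhs zbar W ->
  exists z xi : 'rV[R]_n, [/\ W z, U z, limiting_subgradient f0 z xi,
    `|xi| <= L &
    Mbar (@subdiff R n) phi zbar z (- xi - 2 *: (z - zbar))].
Proof.
move=> nW; have [r r0 rU] := open_closed_ball oU Uzbar.
set X := closed_ball_ Num.norm zbar r in rU.
pose b y := \sum_i penalty (@ineq_idx p q i) (f i y).
pose a y := f0 y + sqdist y zbar.
pose V := [set y | forall i, ineq_idx i -> ~~ active_idx phi zbar i -> f i y <
  0].
have cf i y : U y -> {for y, continuous (f i)}.
  by move=> Uy; exact: lip_on_continuous (lf i).
(* Near zbar, the constraints inactive there remain strictly negative, so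
   the penalty has zero derivative along them. *)
have nV : nbhs zbar V.
  apply: (@filter_forall _ _ (fun i => [set y | ineq_idx i ->
    ~~ active_idx phi zbar i -> f i y < 0]) (nbhs zbar)) => i.
  have [ii|ii] := boolP (ineq_idx i); last first.
    by apply: (@nearW _ (nbhs zbar)).
  have [ai|ai] := boolP (active_idx phi zbar i).
    by apply: (@nearW _ (nbhs zbar)).
  have fi0 : f i zbar < 0.
    have := feas.1 i ii; move: ai; rewrite /active_idx ii /= phiE // lee_fin.
    by rewrite lt_neqAle => -> ->.
  have : \forall y \near zbar, f i y < 0.
    exact: (@cvgr_lt _ _ (nbhs zbar) _ _ _ (cf i zbar Uzbar)).
  by apply: (@filterS _ (nbhs zbar)) => y fy _ _.
have [||||||||k [z [Xz [Wz [Vz Bz]] zmin]]] :=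
  @penalty_localizes R _ X a b zbar (W `&` (V `&` ball zbar r)) => //.
- exact: closed_ball_compact.
- move=> y /set_mem Xy; apply: (@cvgD _ _ _ (nbhs y)).
    exact: (lip_on_continuous oU (rU _ Xy) L0 lf0).
  by apply: sqdist_continuous; [exact: cvg_id|exact: cst_continuous].
- move=> y /set_mem Xy; apply: continuous_at_sum => i.
  apply: (@continuous_comp _ _ _ (f i)); first by apply: cf; exact: rU.
  exact: penalty_continuous.
- by move=> y _; apply: sumr_ge0 => i _; exact: penalty_ge0.
- by rewrite /X /closed_ball_ /= subrr normr0 ltW.
- by rewrite /b big1 // => i _; exact: (feasible_penalty Uzbar).2.
- move=> y Xy by0; have Uy := rU _ Xy.
  have fy : feasible phi y.
    apply/feasible_penalty => // i.
    move/eqP: by0; rewrite psumr_eq0; last by move=> j _; exact: penalty_ge0.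
    by move/allP/(_ i); rewrite mem_index_enum => /(_ isT)/eqP.
  have := hmin Uy fy; rewrite /a sqdistxx; have := sqdist_ge0 y zbar.
  by move=> h1 h2 h3; apply: sqdist_eq0; lra.
- apply: filterI => //; apply: filterI => //; exact: nbhsx_ballx.
have Uz := rU _ Xz.
pose G (i : 'I_(p + q)) (t : R) := k%:R * penalty (ineq_idx i) t.
pose dG (i : 'I_(p + q)) (t : R) := k%:R * penalty' (ineq_idx i) t.
have [|||||xi [eta [hxi nxi heta eqn]]] :=
  @sum_rule R n (p + q) f0 f G dG k%:R L U zbar z oU Uz L0 _ lf0 lf => //.
- by move=> i t; apply: cvgM; [exact: cvg_cst|exact: penalty_continuous].
- by move=> i t; apply: cvgM; [exact: cvg_cst|exact: penalty'_continuous].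
- move=> i s t; have :=
  ler_wpM2l (ler0n R k) (penalty_quadratic_bound (ineq_idx i) s t).
  by rewrite /G /dG; lra.
- apply: filterS (near_closed_ball Bz) => y Xy.
  by have := zmin y Xy; rewrite /a /b /G !mulr_sumr.
exists z, xi; split => //.
have -> : - xi - 2 *: (z - zbar) = \sum_i eta i.
  apply/eqP; rewrite eq_sym -subr_eq0 opprB opprK addrCA.
  by rewrite addrC -[X in _ == X]eqn addrC [X in X == _]addrC [xi + _]addrC.
apply: Mbar_signed_sum heta _ _ => //.
- move=> i ii; rewrite /dG /penalty' ii; apply: mulr_ge0; first exact: ler0n.
  by apply: mulr_ge0 => //; rewrite le_max lexx orbT.
- move=> i ii ai; rewrite /dG /penalty' ii.
  by have /ltW/max_idPr -> := Vz i ii ai; rewrite !mulr0.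
Qed.

(** Compactness of the closed ball of radius L gives an accumulation point xi
    of the vectors in penalized_stationary as z tends to zbar; the
    perturbation 2 (z - zbar) vanishes in the limit. *)
Lemma asymptotic_multipliers : exists2 xi, subdiff phi0 zbar xi &
  outer_limit setT (Mbar (@subdiff R n) phi zbar) zbar (- xi).
Proof.
pose D : set ('rV[R]_n * 'rV[R]_n) :=
  [set w | limiting_subgradient f0 w.1 w.2 /\
  Mbar (@subdiff R n) phi zbar w.1 (- w.2 - 2 *: (w.1 - zbar))].
have [W nW|xi _ clD] := @closure_compact_fiber _ _ D _ zbar
    (@closed_ball_compact R n 0 L).
  have [z [xi [Wz _ hxi nxi hM]]] := penalized_stationary nW.
  by exists z, xi; split => //; rewrite /closed_ball_ /= sub0r normrN.
have c1 : {for (zbar, xi), continuous (@fst 'rV[R]_n 'rV[R]_n)}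
  by exact: cvg_fst.
have c2 : {for (zbar, xi), continuous (@snd 'rV[R]_n 'rV[R]_n)}
  by exact: cvg_snd.
exists xi.
  apply: (limiting_subgradient_subdiff oU Uzbar L0 lf0 phi0E).
  apply: (@closed_closure _ [set w | proximal_subgradient f0 w.1 w.2]).
  move=> V nV; have [w [[h1 _] Vw]] := clD V nV.
  by exists w; split => //; move: h1; rewrite /limiting_subgradient; case: (w).
apply: closure_outer_limit.
have := @closure_map _ _ (fun w : 'rV[R]_n * 'rV[R]_n =>
  (w.1, - w.2 - 2 *: (w.1 - zbar))) D
  [set w | setT w.1 /\ Mbar (@subdiff R n) phi zbar w.1 w.2] (zbar, xi) clD.
rewrite /= subrr scaler0 subr0; apply.
  have c3 : {for (zbar, xi), continuous (fun w : 'rV[R]_n * 'rV[R]_n =>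
      - w.2 - 2 *: (w.1 - zbar))}.
    apply: cvgB; first exact: cvgN.
    by apply: cvgZr; apply: cvgB; [exact: c1|exact: cvg_cst].
  exact: (continuous_at_pair c1 c3).
by apply: (@nearW _ (nbhs (zbar, xi))) => w [].
Qed.

End asymptotic_stationarity.

Lemma locally_lipschitz_uniform (R : realType) (n : nat) (T : finType)
    (psi : T -> 'rV[R]_n -> \bar R) (z : 'rV[R]_n) (W : set 'rV[R]_n) :
  nbhs z W -> (forall t, locally_lipschitz (psi t) z) ->
  exists (L : R) (U : set 'rV[R]_n), [/\ open U, U z, 0 <= L, U `<=` W &
    forall t, lip_on U L (fine \o psi t) /\
              forall y, U y -> psi t y = ((fine \o psi t) y)%:E].
Proof.
move=> nW /choice[Lt /choice[Ut hU]].
pose V := W `&` [set y | forall t, Ut t y].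
have nV : nbhs z V.
  apply: filterI => //;
    apply: (@filter_forall _ _ (fun t => Ut t) (nbhs z)) => t.
  by have [] := hU t.
exists (\sum_t `|Lt t|), (interior V); split.
- exact: open_interior.
- exact: nV.
- exact: sumr_ge0.
- by move=> y /interior_subset [].
- move=> t; have [_ fin lip] := hU t; split => [x y|y].
    move=> /interior_subset[_ /(_ t) xU] /interior_subset[_ /(_ t) yU].
    apply: le_trans (lip _ _ xU yU) _; apply: ler_wpM2r; first exact: enorm_ge0.
    apply: le_trans (ler_norm _) _; rewrite (bigD1 t) //= lerDl.
    exact: sumr_ge0.
  by move=> /interior_subset[_ /(_ t) yU] /=; rewrite fineK // fin.
Qed.

Theorem theorem3p10 (R : realType) (n p q : nat)
    (phi0 : 'rV[R]_n -> \bar R) (phi : 'I_(p + q) -> 'rV[R]_n -> \bar R)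
    (zbar : 'rV[R]_n)
    (hmin : local_minimizer phi0 phi zbar)
    (hlip0 : \forall z \near zbar, locally_lipschitz phi0 z)
    (hlip : forall i, \forall z \near zbar, locally_lipschitz (phi i) z) :
  (wA_regular phi zbar -> stationary (@clarke_subdiff R n) phi0 phi zbar) /\
  (A_regular phi zbar -> stationary (@subdiff R n) phi0 phi zbar).
Proof.
have [feas locmin] := hmin.
have [|L [U [oU Uz L0 UW hU]]] :=
  @locally_lipschitz_uniform R n (option 'I_(p + q))
  (fun t => oapp phi phi0 t) zbar _ locmin.
  by case=> [i|] /=; [exact: nbhs_singleton (hlip i)|exact: nbhs_singleton
    hlip0].
have [lf0 phi0E] := hU None.
have lf i := (hU (Some i)).1.
have phiE i := (hU (Some i)).2.
have min0 y : U y -> feasible phi y -> (fine \o phi0) zbar <= (fine \o phi0) y.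
  by move=> Uy fy; rewrite -lee_fin -phi0E // -phi0E //; exact: UW.
have [xi hxi hout] := @asymptotic_multipliers R n p q phi0 phi zbar
  (fine \o phi0) (fun i => fine \o phi i) L U oU L0 lf0 lf phi0E phiE Uz feas
    min0.
have ne i : subdiff (phi i) zbar !=set0.
  have [v hv] := limiting_subgradient_ex oU Uz L0 (lf i).
  exists v.
  exact: (limiting_subgradient_subdiff oU Uz L0 (lf i) (phiE i) hv).
split => reg; apply: stationary_of_multipliers feas _ hxi (reg _ hout) => // i.
by have [v hv] := ne i; exists v; exact: sub_gen_smallest hv.
Qed.
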